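(* Suppose $n>k\ge\lfloor n/2\rfloor$ (with $k\ge1$). Then $$\operatorname{Hdepth}_1M(n,k)=\operatorname{Hdepth}_nM(n,k)=n-1.$$
   Context: $K$ is a field, $R=K[X_1,\dots,X_n]$. $M(n,k)$ is the $k$-th syzygy module of $K=R/(X_1,\dots,X_n)$ in the Koszul complex: the image of $\partial:\bigwedge^kR^n\to\bigwedge^{k-1}R^n$, $\partial(e_{i_1}\wedge\dots\wedge e_{i_k})=\sum_{r=1}^k(-1)^{r+1}X_{i_r}e_{i_1}\wedge\dots\widehat{e_{i_r}}\dots\wedge e_{i_k}$, where $e_{i_1}\wedge\dots\wedge e_{i_k}$ has multidegree $e_{i_1}+\dots+e_{i_k}$ and standard degree $k$. Subscript $n$: multigrading ($\deg X_i=e_i$); subscript $1$: standard grading ($\deg X_i=1$). A graded retract of $R$ is a graded $K$-subalgebra $S$ with a graded $K$-algebra epimorphism $R\to S$ restricting to the identity on $S$. A Hilbert decomposition of $M$ is a finite family $(S_i,s_i)$, $s_i$ degrees, $S_i$ graded retracts, with $M\cong\bigoplus_iS_i(-s_i)$ as graded $K$-vector spaces; its depth is $\min_i\dim S_i$; $\operatorname{Hdepth}M$ is the maximal depth of a Hilbert decomposition in the respective grading. *)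

(* Defs.v *)
From HB Require Import structures.
From mathcomp Require Import all_boot all_order all_algebra.
From mathcomp Require Import mpoly.

Set Implicit Arguments.
Unset Strict Implicit.
Unset Printing Implicit Defensive.

Import GRing.Theory.
Local Open Scope ring_scope.

Section Defs.
Variables (K : fieldType) (n : nat).

Local Notation R := {mpoly K[n]}.

(** ** Gradings.  A grading is given by the degrees [w i] of the variables
    X_i in a Z-module G: standard grading G = int, w i = 1; multigrading
    G = Z^n, w i = e_i. *)
Section Grading.
Variables (G : zmodType) (w : 'I_n -> G).

Definition mdegw (m : 'X_{1..n}) : G := \sum_(i < n) w i *+ m i.

Definition homog_poly (d : G) (p : R) : Prop :=
  forall m, m \in msupp p -> mdegw m = d.

Definition hcomp (d : G) (p : R) : R :=
  \sum_(m <- msupp p | mdegw m == d) p@_m *: 'X_[m].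

(** Elements of the exterior algebra  /\ R^n = (+)_J R e_J  (J subset of
    {1..n}, e_J = e_{j_1} /\ ... /\ e_{j_r}, j_1 < ... < j_r), stored as their
    coefficient functions J |-> coefficient of e_J. *)
Definition ext_form := {ffun {set 'I_n} -> R}.

Definition basis_deg (J : {set 'I_n}) : G := \sum_(i in J) w i.

Definition homog_ext (d : G) (F : ext_form) : Prop :=
  forall J m, m \in msupp (F J) -> mdegw m + basis_deg J = d.

Definition graded_subalg (S : R -> Prop) : Prop :=
  [/\ S 1,
      (forall f g, S f -> S g -> S (f + g)),
      (forall f g, S f -> S g -> S (f * g)),
      (forall (c : K) f, S f -> S (c *: f)) &
      (forall (d : G) f, S f -> S (hcomp d f))].

Definition graded_retract (S : R -> Prop) : Prop :=
  graded_subalg S /\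
  exists phi : R -> R,
    [/\ (forall f g, phi (f + g) = phi f + phi g),
        (forall f g, phi (f * g) = phi f * phi g),
        (forall (c : K) f, phi (c *: f) = c *: phi f) &
        phi 1 = 1] /\
    (forall d f, homog_poly d f -> homog_poly d (phi f)) /\
    [/\ (forall f, S (phi f)),
        (forall s, S s -> exists f, phi f = s) &
        (forall s, S s -> phi s = s)].

(** A family (S_i, s_i)_{i < m} together with an isomorphism of graded
    K-vector spaces  (+)_i S_i(-s_i)  ~=  M ; the direct sum is the set of
    families (x_i)_i with x_i in S_i, and its degree-d part consists of the
    families with x_i homogeneous of degree d - s_i. *)
Definition graded_iso (M : ext_form -> Prop) (m : nat)
    (S : 'I_m -> R -> Prop) (s : 'I_m -> G) : Prop :=
  exists Phi : ('I_m -> R) -> ext_form,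
    [/\ (forall (c : K) (x y : 'I_m -> R) J,
           Phi (fun i => c *: x i + y i) J = c *: Phi x J + Phi y J),
        (forall x, (forall i, S i (x i)) -> M (Phi x)),
        (forall x y, (forall i, S i (x i)) -> (forall i, S i (y i)) ->
           Phi x = Phi y -> x = y),
        (forall F, M F -> exists2 x, (forall i, S i (x i)) & Phi x = F) &
        (forall d x, (forall i, S i (x i) /\ homog_poly (d - s i) (x i)) ->
           homog_ext d (Phi x))].

End Grading.

Definition ideal_of (S I : R -> Prop) : Prop :=
  [/\ (forall a, I a -> S a), I 0,
      (forall a b, I a -> I b -> I (a + b)) &
      (forall s a, S s -> I a -> I (s * a))].

Definition prime_ideal_of (S P : R -> Prop) : Prop :=
  [/\ ideal_of S P, ~ P 1 &
      (forall a b, S a -> S b -> P (a * b) -> P a \/ P b)].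

Definition krull_dim_ge (S : R -> Prop) (d : nat) : Prop :=
  exists P : nat -> R -> Prop,
    (forall j, (j <= d)%N -> prime_ideal_of S (P j)) /\
    (forall j, (j < d)%N ->
       (forall a, P j a -> P j.+1 a) /\ exists a, P j.+1 a /\ ~ P j a).

(** Hdepth M >= d : there is a Hilbert decomposition of M (in the grading
    w) all of whose retracts have dimension >= d, i.e. of depth >= d. *)
Definition Hdepth_ge (G : zmodType) (w : 'I_n -> G)
    (M : ext_form -> Prop) (d : nat) : Prop :=
  exists (m : nat) (S : 'I_m -> R -> Prop) (s : 'I_m -> G),
    [/\ (forall i, graded_retract w (S i)),
        graded_iso w M S s &
        (forall i, krull_dim_ge (S i) d)].

(** (d F)_J = sum_{i notin J} (-1)^{#{j in J | j < i}} X_i F_{J u {i}},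
    which is the coefficient form of
    d(e_{i_1}/\../\e_{i_k}) = sum_r (-1)^{r+1} X_{i_r} e_{..^i_r..}. *)
Definition koszul_diff (F : ext_form) : ext_form :=
  [ffun J : {set 'I_n} => \sum_(i < n | i \notin J)
               (-1) ^+ #|[set j in J | (j < i)%N]| * 'X_i * F (i |: J)].

Definition syz_module (k : nat) : ext_form -> Prop :=
  fun F => exists E : ext_form,
    (forall J : {set 'I_n}, #|J| != k -> E J = 0) /\ F = koszul_diff E.

End Defs.

Definition std_grading (n : nat) : 'I_n -> int := fun _ => 1.
Definition multi_grading (n : nat) : 'I_n -> 'rV[int]_n :=
  fun i => delta_mx 0 i.

(* Main.v *)
Require Import Defs.
From HB Require Import structures.
From mathcomp Require Import all_boot all_order all_algebra zify.
From mathcomp Require Import mpoly.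
From Stdlib Require Import FunctionalExtensionality.

(** Lower bound.  In multidegree a with support A, the Koszul boundaries
    X^(a - e_J) d(e_J) with |J| = k, p in J, J a subset of A, form a basis of
    M(n,k)_a, where p is any fixed element of A.  The pieces of the Hilbert
    decomposition are indexed by the sets B with |B| >= k and |B| = k mod 2,
    with shift e_B.  When n./2 <= k, there is an injection f from the sets C
    with |C| > k to sets of one element less with f C a subset of C; the piece
    of B = f C omits the one variable in C \ B, an unmatched piece is free.
    The number of pieces that meet degree a is
    #{B <= A even} - #{C <= A odd}, parity and size being relative to k, and
    toggling p shows that this is also the number of the sets J above.

    Upper bound.  A chain of n + 1 primes in a retract S of R with a nonzero
    kernel would give a chain of n + 2 primes in R, so all the retracts of a
    decomposition of depth n are equal to R.  The copies of R that start in
    degree k would then contribute n * 'C(n, k) independent elements in degree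
    k + 1, but M(n,k) is generated in degree k by 'C(n, k) elements that have a
    linear relation d(d(e_C)) = 0, |C| = k + 1. *)

Set Implicit Arguments.
Unset Strict Implicit.
Unset Printing Implicit Defensive.

Import GRing.Theory.

(** * The shadow matching *)

Section ShadowMatching.
Variable n : nat.
Implicit Types B C : {set 'I_n}.

Definition prefix_card B (i : nat) : nat := #|[set j in B | j < i]|.

Lemma prefix_card_setU1 B (t : 'I_n) i : t \notin B ->
  prefix_card (t |: B) i = (t < i) + prefix_card B i.
Proof.
move=> tB; rewrite /prefix_card; case: (ltnP t i) => ti /=.
  rewrite (_ : [set j in t |: B | j < i] = t |: [set j in B | j < i]).
    by rewrite cardsU1 inE (negPf tB).
  by apply/setP=> j; rewrite !inE andb_orl; case: eqP => // ->; rewrite ti.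
congr #|pred_of_set _|; apply/setP=> j; rewrite !inE andb_orl.
by case: eqP => // ->; rewrite ltnNge ti (negPf tB).
Qed.

Lemma prefix_card_full B : prefix_card B n = #|B|.
Proof. by congr #|pred_of_set _|; apply/setP=> j;
  rewrite inE ltn_ord andbT. Qed.

Lemma prefix_card_succ B (t : 'I_n) :
  prefix_card B t.+1 = (t \in B) + prefix_card B t.
Proof.
rewrite /prefix_card (cardsD1 t) !inE ltnSn andbT; congr (_ + _).
congr #|pred_of_set _|; apply/setP=> j; rewrite !inE ltnS.
by rewrite (ltn_neqAle j) -(inj_eq val_inj); case: (j \in B); rewrite ?andbF.
Qed.

Lemma last_minimum (f : nat -> int) N :
  exists2 t, t <= N &
    forall i, i <= N -> (f t <= f i)%R /\ (t < i -> (f t < f i)%R).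
Proof.
elim: N => [|N [t tN tmin]].
  by exists 0 => // i; rewrite leqn0 => /eqP ->; split; [|rewrite ltnn].
have [le|lt] := boolP (f N.+1 <= f t)%R.
  exists N.+1 => // i iN; split; last by lia.
  have [/tmin []|] := leqP i N; first by lia.
  by move=> Ni; have -> : i = N.+1 by lia.
exists t; first by lia.
move=> i iN; have [iN'|Ni] := leqP i N; first exact: tmin.
have -> : i = N.+1 by lia.
by split; lia.
Qed.

(** The lattice path of [B]: from position [i] to [i + 1] it goes up by one if [i] is in [B] and
    down by one otherwise. *)
Definition walk B (i : nat) : int := ((prefix_card B i).*2%:Z - i%:Z)%R.

(* The matching pairs B with t |: B; then t is also the last minimum of the walk
   of t |: B, so t can be read off from either set. *)
Definition first_min B (t : nat) :=
  (forall i, i <= t -> (walk B t.+1 < walk B i)%R) /\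
  (forall i, t < i -> i <= n -> (walk B t.+1 <= walk B i)%R).

Lemma first_min_uniq B (t u : 'I_n) : first_min B t -> first_min B u -> t = u.
Proof.
move=> [t1 t2] [u1 u2]; apply/val_inj/eqP; rewrite eqn_leq.
apply/andP; split; rewrite leqNgt; apply/negP=> /= lt.
  by have := t1 _ lt; have := u2 t.+1 (leqW lt) (ltn_ord t); lia.
by have := u1 _ lt; have := t2 u.+1 (leqW lt) (ltn_ord u); lia.
Qed.

(** Let [t] be the position of the last minimum of the walk of [C]. The step after it goes up, so
    [t] lies in [C]. Removing [t] turns this step down and lowers everything after it by 2, which
    makes [t + 1] the first minimum of the new walk. *)
Lemma first_min_exists C : n < #|C|.*2 ->
  exists2 t : 'I_n, t \in C & first_min (C :\ t) t.
Proof.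
move=> nC; have [t0 t0n tmin] := last_minimum (walk C) n.
(* The walk starts at 0 and ends at [2 * #|C| - n], which is positive, so its minimum is not
   attained at [n]. *)
have t0lt : t0 < n.
  rewrite ltn_neqAle t0n andbT; apply/eqP=> t0E.
  have [] := tmin 0 isT; rewrite t0E /walk prefix_card_full.
  have -> : prefix_card C 0 = 0.
    by apply/eqP; rewrite cards_eq0; apply/eqP/setP=> j; rewrite !inE andbF.
  by lia.
pose t := Ordinal t0lt.
have tC : t \in C.
  have [_] := tmin t.+1 (ltn_ord t); rewrite ltnSn => /(_ isT).
  by rewrite /walk prefix_card_succ /=; case: (t \in C) => //=; lia.
have pC i : prefix_card C i = (t < i) + prefix_card (C :\ t) i.
  by rewrite -{1}(setD1K tC) prefix_card_setU1 // !inE eqxx.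
exists t => //; split=> i.
  move=> it; have [+ _] := tmin i (ltnW (leq_ltn_trans it (ltn_ord t))).
  have := prefix_card_succ (C :\ t) t; rewrite !inE eqxx /=.
  by rewrite /walk !pC ltnn (ltnNge t i) it /=; lia.
move=> ti iN; have [_ /(_ ti)] := tmin i iN.
have := prefix_card_succ (C :\ t) t; rewrite !inE eqxx /=.
by rewrite /walk !pC ltnn ti /=; lia.
Qed.

(** The removed element can be recovered from [f C] as the position of its first minimum, whence
    injectivity. *)
Lemma shadow_matching : exists f : {set 'I_n} -> {set 'I_n},
  (forall C, n < #|C|.*2 -> exists2 t, t \in C & f C = C :\ t) /\
  (forall C D : {set 'I_n}, n < #|C|.*2 -> n < #|D|.*2 -> f C = f D -> C = D).
Proof.
have ex C : exists B, n < #|C|.*2 ->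
    exists2 t, t \in C & B = C :\ t /\ first_min B t.
  have [/first_min_exists[t tC tm]|nC] := boolP (n < #|C|.*2).
    by exists (C :\ t) => _; exists t.
  (* A default value: nothing is required of [f] on the sets with at most half of the elements. *)
  by exists C.
have [f fP] := fin_all_exists ex; exists f; split=> [C /fP[t tC []]|].
  by exists t.
move=> C D /= /fP[t tC [fC tm]] /fP[u uD [fD um]] eq_f.
rewrite eq_f in fC tm; have tu := first_min_uniq tm um; subst u.
by rewrite -(setD1K tC) -(setD1K uD) -fC -fD.
Qed.

End ShadowMatching.

(** * Krull dimension of retracts *)

Section LinearDependence.
Local Open Scope ring_scope.
Variable K : fieldType.

Lemma linear_dependence (A B : finType) (f : A -> B -> K) : (#|B| < #|A|)%N ->
  exists2 v : A -> K, (exists a, v a != 0) &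
    forall b, \sum_a v a * f a b = 0.
Proof.
move=> BA; pose Mf := \matrix_(i < #|A|, j < #|B|) f (enum_val i) (enum_val j).
have /rowV0Pn[u /sub_kermxP uM u0] : kermx Mf != 0.
  rewrite kermx_eq0 /row_free neq_ltn.
  by rewrite (leq_ltn_trans (rank_leq_col _) BA).
have [j uj] : exists j, u 0 j != 0.
  apply/existsP; apply: contraNT u0 => /existsPn h.
  by apply/eqP/rowP=> j; rewrite mxE; apply/eqP; have := h j; rewrite negbK.
exists (fun a => u 0 (enum_rank a)).
  by exists (enum_val j); rewrite enum_valK.
move=> b; have := congr1 (fun M : 'rV_ _ => M 0 (enum_rank b)) uM.
rewrite mxE [RHS]mxE => uM0; rewrite -[RHS]uM0.
rewrite (reindex (@enum_val A A)) /=; last exact/onW_bij/enum_val_bij.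
by apply: eq_bigr => i _; rewrite mxE enum_rankK enum_valK.
Qed.

End LinearDependence.

Section KrullDimension.
Local Open Scope ring_scope.
Variables (K : fieldType) (n : nat).
Local Notation R := {mpoly K[n]}.

Lemma msizeM_leq (p q : R) : (msize (p * q) <= (msize p + msize q).-1)%N.
Proof.
have [->|p0] := eqVneq p 0; first by rewrite mul0r msize0.
have [->|q0] := eqVneq q 0; first by rewrite mulr0 msize0.
by rewrite msizeM.
Qed.

Lemma msize_prod_exp (I : finType) (x : I -> R) (a : I -> nat) (D B : nat) :
  (forall i, (msize (x i) <= D.+1)%N) -> (forall i, (a i <= B)%N) ->
  (msize (\prod_i x i ^+ a i) <= (#|I| * (B * D)).+1)%N.
Proof.
move=> xD aB.
have xa i : (msize (x i ^+ a i) <= (B * D).+1)%N.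
  suff h m : (msize (x i ^+ m) <= (m * D).+1)%N.
    by apply: leq_trans (h _) _; rewrite ltnS leq_mul2r aB orbT.
  elim: m => [|m IH]; first by rewrite expr0 msize1.
  rewrite exprS; apply: leq_trans (msizeM_leq _ _) _.
  by have := xD i; lia.
rewrite -sum1_card big_distrl /=.
elim/big_rec2: _ => [|i p m _ IH]; first by rewrite msize1.
by apply: leq_trans (msizeM_leq _ _) _; have := xa i; lia.
Qed.

(** A count of dimensions: the products of the [x i] with all exponents below [B] are more numerous
    than the monomials that can occur in them. *)
Lemma algebraic_dependence (x : 'I_n.+1 -> R) :
  exists B (c : {ffun 'I_n.+1 -> 'I_B} -> K), (exists a, c a != 0) /\
    \sum_a c a *: \prod_i x i ^+ a i = 0.
Proof.
pose D := \max_i msize (x i).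
have xD i : (msize (x i) <= D.+1)%N.
  by apply: leqW; apply: (leq_bigmax_cond (F := fun i => msize (x i))).
(* All products have degree below [d], and [d <= B * ((n+1) * D + 1)]. Hence [d ^ n <= B ^ n *
   ((n+1) * D + 1) ^ n < B ^ (n+1)] by the choice of [B]. *)
pose B := ((n.+1 * D).+1 ^ n).+1.
pose d := (n.+1 * (B * D)).+1.
pose f (a : {ffun 'I_n.+1 -> 'I_B}) (b : {ffun 'I_n -> 'I_d}) : K :=
  (\prod_i x i ^+ a i)@_[multinom (b i : nat) | i < n].
have [|v v0 vf] := @linear_dependence K _ _ f.
  rewrite !card_ffun !card_ord expnS.
  have le : (d <= B * (n.+1 * D).+1)%N by rewrite /d; lia.
  have leX a b : (a <= b -> a ^ n <= b ^ n)%N.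
    by case: (posnP n) => [->|n0] //; rewrite leq_exp2r.
  have := leX _ _ le.
  rewrite expnMn => /leq_ltn_trans; apply.
  by rewrite [(B * _)%N]mulnC ltn_pmul2l ?expn_gt0 // ltnSn.
exists B, v; split=> //; apply/mpolyP=> m; rewrite mcoeff0 raddf_sum /=.
have [md|md] := ltnP (mdeg m) d.
  have mi i : (m i < d)%N.
    by apply: leq_ltn_trans md; rewrite mdegE (bigD1 i) //= leq_addr.
  rewrite -[RHS](vf [ffun i => Ordinal (mi i)]); apply: eq_bigr => a _.
  rewrite mcoeffZ /f; congr (_ * _@__); apply/mnmP=> i.
  by rewrite mnmE ffunE.
rewrite big1 // => a _; rewrite mcoeffZ memN_msupp_eq0 ?mulr0 //.
apply: msize_mdeg_ge; apply: leq_trans md.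
have := @msize_prod_exp _ x (fun i => a i) D B xD (fun i => ltnW (ltn_ord _)).
by rewrite card_ord.
Qed.

Lemma prime_ideal_exp (P : R -> Prop) x y m :
  prime_ideal_of (fun=> True) P -> ~ P x -> P (x ^+ m * y) -> P y.
Proof.
move=> [_ _ prP] Px; elim: m => [|m IH]; first by rewrite expr0 mul1r.
by rewrite exprS -mulrA => /prP[] // /IH.
Qed.

Lemma ideal_sum (P : R -> Prop) (I : finType) (Q : pred I) (F : I -> R) :
  ideal_of (fun=> True) P -> (forall i, Q i -> P (F i)) ->
  P (\sum_(i | Q i) F i).
Proof. by move=> [_ P0 PD _] PF; apply: (big_ind P). Qed.

(* Successively passing to the terms of smallest x_i-exponent isolates one
   nonzero constant. *)
Lemma prime_chain_independent N B (P : nat -> R -> Prop) (x : 'I_N -> R)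
    (c : {ffun 'I_N -> 'I_B} -> K) (i : nat) (A : {set {ffun 'I_N -> 'I_B}}) :
  (forall j, (j <= N)%N -> prime_ideal_of (fun=> True) (P j)) ->
  (forall j : 'I_N,
    [/\ forall a, P j a -> P j.+1 a, P j.+1 (x j) & ~ P j (x j)]) ->
  (i <= N)%N -> A != set0 -> (forall a, a \in A -> c a != 0) ->
  (forall a b (j : 'I_N), a \in A -> b \in A -> (j < i)%N -> a j = b j) ->
  P i (\sum_(a in A) c a *: \prod_(j < N | (i <= j)%N) x j ^+ a j) -> False.
Proof.
move=> prP chP iN; have [d] := ubnP (N - i).
elim: d => // d IH in i A iN *; rewrite ltnS => Nd A0 cA eqA PA.
have [a0 a0A] := set0Pn _ A0.
move: iN; rewrite leq_eqVlt => /orP[/eqP iN|iN].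
  have [[_ _ _ PM] P1 _] := prP i (eq_leq iN).
  apply: P1; have Aa0 : A = [set a0].
    apply/setP=> a; rewrite inE; apply/idP/eqP=> [aA|-> //].
    by apply/ffunP=> j; apply: eqA => //; rewrite iN.
  move: PA; rewrite Aa0 big_set1 big_pred0 => [Pc|j]; last first.
    by rewrite iN leqNgt ltn_ord.
  have := PM (c a0)^-1%:MP _ Logic.I Pc.
  by rewrite mul_mpolyC scalerA mulVf ?cA // scale1r.
pose j := Ordinal iN.
have [a1 a1A a1min] : exists2 a1, a1 \in A &
    forall a, a \in A -> (a1 j <= a j)%N.
  by case: (arg_minnP (fun a : {ffun 'I_N -> 'I_B} => a j : nat) a0A) => a1;
    exists a1.
have [/= PjS Pxj NPxj] := chP j.
pose A' := [set a in A | a j == a1 j].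
apply: (IH i.+1 A') => //=.
- by lia.
- by apply/set0Pn; exists a1; rewrite inE a1A /=.
- by move=> a; rewrite inE => /andP[/cA].
- move=> a b l; rewrite !inE => /andP[aA /eqP aj] /andP[bA /eqP bj].
  rewrite ltnS leq_eqVlt => /orP[/eqP li|]; last exact: eqA.
  by rewrite (_ : l = j) ?aj ?bj //; apply: val_inj.
have prodE a : a \in A -> \prod_(l < N | (i <= l)%N) x l ^+ a l =
    x j ^+ a1 j * (x j ^+ (a j - a1 j) * \prod_(l < N | (i < l)%N) x l ^+ a l).
  move=> aA; rewrite mulrA -exprD subnKC ?a1min // (bigD1 j) //=; congr (_ * _).
  by apply: eq_bigl => l;
    rewrite andbC -(inj_eq val_inj) /= [RHS]ltn_neqAle eq_sym.
have {PA} : P i (x j ^+ a1 j * \sum_(a in A)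
    c a *: (x j ^+ (a j - a1 j) * \prod_(l < N | (i < l)%N) x l ^+ a l)).
  rewrite big_distrr /=; move: PA; congr (P i _); apply: eq_bigr => a aA.
  by rewrite prodE // scalerAr.
(* The common power of [x j] cancels, since [x j] is outside the prime [P i]. In [P i.+1], which
   contains [x j], the terms with a larger exponent ([S2]) can then be discarded. *)
move/(prime_ideal_exp (prP i (ltnW iN)) NPxj)/PjS.
have idP1 := prP i.+1 iN; have [[_ _ PD PM] _ _] := idP1.
rewrite (bigID (fun a : {ffun 'I_N -> 'I_B} => a j == a1 j)) /=.
set S1 := \sum_(_ in _ | _) _; set S2 := \sum_(_ in _ | _) _ => PS.
have PS2 : P i.+1 S2.
  have [idP _ _] := idP1; apply: ideal_sum => // a /andP[aA aj].
  have lt : (0 < a j - a1 j)%N.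
    by rewrite subn_gt0 ltn_neqAle a1min // andbT eq_sym.
  rewrite -(prednK lt) exprS -mulrA [x j * _]mulrC scalerAl.
  exact: PM.
have := PD _ _ PS (PM (-1) _ Logic.I PS2); rewrite mulN1r addrK.
congr (P i.+1 _); apply: eq_big => [a|a /andP[aA /eqP ->]];
  first by rewrite inE.
by rewrite subnn expr0 mul1r.
Qed.

(** Elements [x j] of [P j.+1] outside [P j], for [n + 1] successive steps of a chain, would be
    algebraically dependent. Their relation puts 0 in the form excluded by
    [prime_chain_independent]. *)
Lemma krull_dim_mpoly d : krull_dim_ge (fun _ : R => True) d -> (d <= n)%N.
Proof.
move=> [P [prP chP]]; rewrite leqNgt; apply/negP=> nd.
have [x xP] : exists x : 'I_n.+1 -> R,
      forall j : 'I_n.+1, P j.+1 (x j) /\ ~ P j (x j).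
  apply: (fin_all_exists (P := fun (j : 'I_n.+1) y => P j.+1 y /\ ~ P j y)) =>
    j.
  by have [_] := chP j (leq_trans (ltn_ord j) nd).
have [B [c [[a ca] cx]]] := algebraic_dependence x.
apply: (@prime_chain_independent n.+1 B P x c 0 [set a | c a != 0]) => //.
- by move=> j jn; apply: prP; apply: leq_trans jn nd.
- move=> j; have [PP _] := chP j (leq_trans (ltn_ord j) nd).
  by have [] := xP j.
- by apply/set0Pn; exists a; rewrite inE.
- by move=> b; rewrite inE.
have [[_ P0 _ _] _ _] := prP 0%N isT.
rewrite (_ : \sum_(_ in _) _ = 0) // -[RHS]cx [RHS](bigID (fun a => c a != 0))
  /=.
rewrite [X in _ + X]big1 ?addr0; last first.
  by move=> b; rewrite negbK => /eqP ->; rewrite scale0r.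
by apply: eq_bigl => b; rewrite inE.
Qed.

(** Since [f - phi f] lies in the kernel of [phi], it is enough that [phi] is injective; otherwise
    [R] would have a chain of primes of length [n + 1]. *)
Lemma retract_full (S : R -> Prop) (phi : R -> R) :
  (forall f g, phi (f + g) = phi f + phi g) ->
  (forall f g, phi (f * g) = phi f * phi g) ->
  phi 1 = 1 ->
  (forall f, S (phi f)) -> (forall s, S s -> phi s = s) ->
  krull_dim_ge S n -> forall f, S f.
Proof.
move=> phiD phiM phi1 Sphi phiS [P [prP chP]] f.
have phi0 : phi 0 = 0 by apply: (addrI (phi 0)); rewrite -phiD !addr0.
suff ker0 g : phi g = 0 -> g = 0.
  suff -> : f = phi f by [].
  apply/eqP; rewrite -subr_eq0; apply/eqP/ker0.
  have phiN g : phi (- g) = - phi g.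
    by apply: (addrI (phi g)); rewrite -phiD !subrr.
  by rewrite phiD phiN (phiS (phi f)) ?subrr.
move=> pg; apply/eqP/negPn/negP=> g0.
have : krull_dim_ge (fun _ : R => True) n.+1; last first.
  by move/krull_dim_mpoly; rewrite ltnn.
(* The zero ideal, followed by the preimages of the chain in [S]. The first inclusion is strict
   because of the nonzero [g] in the kernel. *)
exists (fun j a => if j is j'.+1 then P j' (phi a) else a = 0); split.
  case=> [_|j].
    split=> [|/eqP|a b _ _ /eqP]; first split=> //.
    - by move=> a b -> ->; rewrite addr0.
    - by move=> s a _ ->; rewrite mulr0.
    - by rewrite oner_eq0.
    - by rewrite mulf_eq0 => /orP[] /eqP; [left|right].
  rewrite ltnS => /prP[[PS P0 PD PM] P1 Ppr].
  split=> [||a b _ _]; first split=> //.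
  - by rewrite phi0.
  - by move=> a b; rewrite phiD; apply: PD.
  - by move=> s a _; rewrite phiM; apply: PM.
  - by rewrite phi1.
  - by rewrite phiM; apply: Ppr.
case=> [_|j].
  have [[_ P0 _ _] _ _] := prP 0%N isT.
  split=> [a ->|]; first by rewrite phi0.
  by exists g; rewrite pg; split=> //; apply/eqP.
rewrite ltnS => jn; have [PP [a [Pa NPa]]] := chP j jn.
split=> [b|]; first exact: PP.
have [[PS _ _ _] _ _] := prP j.+1 jn.
by exists a; rewrite phiS //; apply: PS.
Qed.

End KrullDimension.

(** * Koszul boundaries *)

Section Koszul.
Local Open Scope ring_scope.
Variables (K : fieldType) (n : nat).
Local Notation R := {mpoly K[n]}.
Local Notation E := {ffun {set 'I_n} -> R}.
Implicit Types (J L C : {set 'I_n}) (a m : 'X_{1..n}).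

Definition mnm_supp a : {set 'I_n} := [set i | (0 < a i)%N].

Lemma mnm_mesym1E J i : mesym1 J i = (i \in J) :> nat.
Proof. by rewrite mnmE. Qed.

Lemma mesym1_le J a : (mesym1 J <= a)%MM = (J \subset mnm_supp a).
Proof.
apply/mnm_lepP/subsetP => [h i iJ|h i]; first by have := h i;
  rewrite mnm_mesym1E iJ inE.
by rewrite mnm_mesym1E; case: (boolP (i \in J)) => // /h; rewrite inE.
Qed.

Lemma mnm_suppD a m : mnm_supp (a + m)%MM = mnm_supp a :|: mnm_supp m.
Proof. by apply/setP=> i; rewrite !inE mnmDE addn_gt0. Qed.

Lemma mnm_supp_mesym1 J : mnm_supp (mesym1 J) = J.
Proof. by apply/setP=> i; rewrite !inE mnm_mesym1E lt0b. Qed.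

Lemma mesym1U1 J i : i \notin J -> mesym1 (i |: J) = (U_(i) + mesym1 J)%MM.
Proof.
move=> iJ; apply/mnmP=> j; rewrite mnmDE mnm1E !mnm_mesym1E !inE [i == j]eq_sym.
by case: eqP => // ->; rewrite (negPf iJ).
Qed.

(** For [i] outside [L], this is the sign that sorts the wedge product of [e_i] and [e_L]. *)
Definition ksign L (i : 'I_n) : K := (-1) ^+ #|[set j in L | (j < i)%N]|.

(* The entry of the Koszul differential at (e_J, e_L), without its variable. *)
Definition kcoef J L : K := \sum_(i | (i \notin L) && (i |: L == J)) ksign L i.

Lemma kcoefD1 J p : p \in J -> kcoef J (J :\ p) = ksign (J :\ p) p.
Proof.
move=> pJ; rewrite /kcoef (big_pred1 p) // => i /=;
  apply/andP/eqP => [[iL /eqP h]|->].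
  by move: pJ; rewrite -h !inE eqxx /= orbF => /eqP.
by rewrite !inE eqxx setD1K.
Qed.

Lemma kcoefD1_neq0 J p : p \in J -> kcoef J (J :\ p) != 0.
Proof. by move=> pJ; rewrite kcoefD1 // signr_eq0. Qed.

Lemma kcoef_neq0 J L : kcoef J L != 0 -> exists2 i, i \in J & L = J :\ i.
Proof.
move=> h; have [i /andP[iL /eqP <-]|no] := pickP (fun i => (i \notin L) && (i
  |: L == J)).
  by exists i; rewrite ?setU1K // !inE eqxx.
by move: h; rewrite /kcoef big_pred0 ?eqxx.
Qed.

Lemma ksignU1 L i j : i \notin L -> ksign (i |: L) j = (-1) ^+ (i < j)%N *
  ksign L j.
Proof.
by move=> iL; rewrite /ksign -exprD -(prefix_card_setU1 j iL).
Qed.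

(** The identity of a complex on the level of signs: removing [i] and [j] from [C] in the two
    possible orders gives opposite terms. *)
Lemma kcoef_comp C L : \sum_J kcoef C J * kcoef J L = 0.
Proof.
pose Q i j := [&& i \notin L, j \notin L, i != j & j |: (i |: L) == C].
pose F i j := ksign (i |: L) j * ksign L i.
have Qsym i j : Q i j = Q j i.
  by rewrite /Q setUCA eq_sym; case: (i \in L); case: (j \in L).
have Fanti i j : Q i j -> F j i = - F i j.
  case/and4P=> iL jL ij _; rewrite /F !ksignU1 //.
  move: ij; rewrite -(inj_eq val_inj) /= neq_ltn => /orP[] lt.
    by rewrite lt (ltnNge j) (ltnW lt) /= expr1 expr0 mulN1r mul1r mulNr opprK
      mulrC.
  by rewrite lt (ltnNge i) (ltnW lt) /= expr1 expr0 mulN1r mul1r mulNr mulrC.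
have -> : \sum_J kcoef C J * kcoef J L = \sum_i \sum_(j | Q i j) F i j.
  under eq_bigr => J _ do rewrite mulrC [kcoef J L]/kcoef big_distrl /=.
  rewrite (exchange_big_dep (fun i => i \notin L)) /=;
    last by move=> J i _ /andP[].
  rewrite big_mkcond /=; apply: eq_bigr => i _; case: ifPn => [|/negPn] iL;
    last first.
    by rewrite big_pred0 // => j; rewrite /Q iL.
  rewrite (big_pred1 (i |: L)) => [|J]; last by rewrite /= iL eq_sym.
  rewrite mulrC big_distrl; apply: eq_bigl => j; rewrite /Q iL !inE negb_or.
  by rewrite eq_sym; case: (j \notin L); case: (i == j).
rewrite pair_big_dep /= (bigID (fun ij : 'I_n * 'I_n => (ij.1 < ij.2)%N)) /=.
rewrite [X in _ + X](reindex (fun ij : 'I_n * 'I_n => (ij.2, ij.1))) /=;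
  last first.
  by exists (fun ij => (ij.2, ij.1)) => -[].
rewrite [X in _ + X](eq_bigl (fun ij : 'I_n * 'I_n => Q ij.1 ij.2 && (ij.1 <
  ij.2)%N)).
  by rewrite -big_split /= big1 // => -[i j] /andP[Qij _] /=;
    rewrite (Fanti i j) // subrr.
move=> [i j] /=; rewrite Qsym -leqNgt leq_eqVlt; case: (boolP (Q i j)) => //.
by case/and4P=> _ _ + _; rewrite -(inj_eq val_inj) /= => /negPf ->.
Qed.

Lemma koszul_diff_is_linear : linear (@koszul_diff K n).
Proof.
move=> c F G; apply/ffunP=> L; rewrite !ffunE scaler_sumr -big_split /=.
by apply: eq_bigr => i _; rewrite !ffunE mulrDr scalerAr.
Qed.

HB.instance Definition _ :=
  GRing.isLinear.Build K E E *:%R (@koszul_diff K n) koszul_diff_is_linear.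

Definition single J (p : R) : E := [ffun L => if L == J then p else 0].

(** The boundary of [X^(a - e_J) e_J], of multidegree [a]. The subtraction of exponents is
    truncated, so this reading needs [J] to be contained in the support of [a]. *)
Definition kgen a J : E := koszul_diff (single J 'X_[a - mesym1 J]).

(** The monomial on the right does not depend on [J], so inside one multidegree only the scalar
    matrix [kcoef] matters. *)
Lemma kgenE a J L : J \subset mnm_supp a ->
  kgen a J L = kcoef J L *: 'X_[a - mesym1 L].
Proof.
rewrite -mesym1_le => Ja; rewrite ffunE /kcoef scaler_suml.
rewrite [LHS](bigID (fun i => i |: L == J)) /= [X in _ + X]big1 ?addr0;
  last first.
  by move=> i /andP[_ /negPf h]; rewrite ffunE h mulr0.
apply: eq_bigr => i /andP[iL /eqP iLJ]; rewrite ffunE iLJ eqxx -mulrA -mpolyXD.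
rewrite /ksign -[in LHS]signr_odd -[in RHS]signr_odd mulr_sign scaler_sign.
suff -> : (U_(i) + (a - mesym1 J) = a - mesym1 L)%MM by [].
apply/mnmP=> j; move/mnm_lepP/(_ j): Ja;
  rewrite -iLJ mesym1U1 // !(mnmDE, mnmBE); lia.
Qed.

Lemma ext_singleE (F : E) :
  F = \sum_J \sum_(m <- msupp (F J)) (F J)@_m *: single J 'X_[m].
Proof.
apply/ffunP=> L; rewrite sum_ffunE (bigD1 L) //= [X in _ + X]big1 ?addr0.
  rewrite sum_ffunE {1}[F L]mpolyE; apply: eq_bigr => m _.
  by rewrite !ffunE eqxx.
move=> J JL; rewrite sum_ffunE big1 // => m _.
by rewrite !ffunE eq_sym (negPf JL) scaler0.
Qed.

Lemma koszul_diffE (F : E) : koszul_diff F =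
  \sum_J \sum_(m <- msupp (F J)) (F J)@_m *: kgen (m + mesym1 J) J.
Proof.
rewrite {1}[F]ext_singleE linear_sum; apply: eq_bigr => J _.
by rewrite linear_sum; apply: eq_bigr => m _; rewrite linearZ /kgen addmK.
Qed.

Lemma kgen_homog a J L m : J \subset mnm_supp a ->
  m \in msupp (kgen a J L) -> (m + mesym1 L)%MM = a.
Proof.
move=> Ja; rewrite kgenE // mcoeff_msupp mcoeffZ mcoeffX mulf_eq0 negb_or.
case/andP=> /kcoef_neq0[i iJ ->]; case: (_ =P m) => [<- _|];
  last by rewrite eqxx.
by rewrite submK // mesym1_le (subset_trans _ Ja) // subD1set.
Qed.

(** This relation lets a generator whose set misses [p] be replaced by generators whose sets contain
    [p]. *)
Lemma kgen_relation a C : C \subset mnm_supp a ->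
  \sum_J kcoef C J *: kgen a J = 0.
Proof.
move=> Ca; apply/ffunP=> L; rewrite sum_ffunE ffunE.
transitivity (\sum_J (kcoef C J * kcoef J L) *: ('X_[a - mesym1 L] : R));
  last first.
  by rewrite -scaler_suml kcoef_comp scale0r.
apply: eq_bigr => J _; rewrite ffunE.
have [->|/kcoef_neq0[i iC JE]] := eqVneq (kcoef C J) 0.
  by rewrite mul0r !scale0r.
by rewrite kgenE ?scalerA // JE (subset_trans _ Ca) // subD1set.
Qed.

Lemma koszul_diff_kgen a C : C \subset mnm_supp a ->
  koszul_diff (kgen a C) = 0.
Proof.
move=> Ca; rewrite -[RHS](kgen_relation Ca).
have -> : kgen a C = \sum_J kcoef C J *: single J 'X_[a - mesym1 J].
  apply/ffunP=> L; rewrite sum_ffunE (bigD1 L) //= [X in _ + X]big1 ?addr0.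
    by rewrite kgenE // !ffunE eqxx.
  by move=> J JL; rewrite !ffunE eq_sym (negPf JL) scaler0.
by rewrite linear_sum; apply: eq_bigr => J _; rewrite linearZ.
Qed.

Variable k : nat.

Lemma syz_kgen a J : #|J| = k -> @syz_module K n k (kgen a J).
Proof.
move=> Jk; exists (single J 'X_[a - mesym1 J]); split=> // L Lk.
by rewrite ffunE; case: eqP => // LJ; rewrite LJ Jk eqxx in Lk.
Qed.

Lemma syz0 : @syz_module K n k 0.
Proof.
exists 0; split=> [J _|]; first by rewrite ffunE.
by rewrite linear0.
Qed.

Lemma syz_linear c (F G : E) :
  @syz_module K n k F -> @syz_module K n k G -> @syz_module K n k (c *: F + G).
Proof.
move=> [F' [F0 ->]] [G' [G0 ->]]; exists (c *: F' + G'); split=> [J Jk|].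
  by rewrite !ffunE F0 // G0 // scaler0 addr0.
by rewrite linearP.
Qed.

(** An induction principle: over [K], the module is spanned by the boundaries [kgen a J]. *)
Lemma syz_ind (Q : E -> Prop) :
  Q 0 -> (forall c F G, Q F -> Q G -> Q (c *: F + G)) ->
  (forall a J, J \subset mnm_supp a -> #|J| = k -> Q (kgen a J)) ->
  forall F, @syz_module K n k F -> Q F.
Proof.
move=> Q0 Qlin Qgen F [G [G0 ->]]; rewrite koszul_diffE.
have QD F1 F2 : Q F1 -> Q F2 -> Q (F1 + F2).
  by move=> Q1 Q2; rewrite -[F1]scale1r; apply: Qlin.
apply: (big_ind Q) => // J _.
have [Jk|/eqP Jk] := eqVneq #|J| k; last first.
  by rewrite G0 ?msupp0 ?big_nil //; apply/eqP.
apply: (big_ind Q) => // m _; rewrite -[_ *: _]addr0; apply: Qlin => //.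
by apply: Qgen => //; rewrite mnm_suppD mnm_supp_mesym1 subsetUr.
Qed.

Lemma syz_sum (I : Type) (r : seq I) (P : pred I) (F : I -> E) :
  (forall i, P i -> @syz_module K n k (F i)) ->
  @syz_module K n k (\sum_(i <- r | P i) F i).
Proof.
move=> h; apply: (big_ind (@syz_module K n k)) => // [|F1 F2 h1 h2].
  exact: syz0.
by rewrite -[F1]scale1r; apply: syz_linear.
Qed.

End Koszul.

(** * The combinatorial partition *)

Lemma equal_card_bijection (T U : finType) (u0 : U) (I : {set T}) (J : {set U})
  :
  #|I| = #|J| -> exists b : T -> U,
    [/\ forall i, i \in I -> b i \in J,
        forall i i', i \in I -> i' \in I -> b i = b i' -> i = i' &
        forall j, j \in J -> exists2 i, i \in I & b i = j].
Proof.
rewrite !cardE => IJ.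
exists (fun i => nth u0 (enum J) (index i (enum I))).
have lt i : i \in I -> index i (enum I) < size (enum J).
  by move=> iI; rewrite -IJ index_mem mem_enum.
split=> [i iI|i i' iI i'I /eqP|j jJ].
- by rewrite -mem_enum mem_nth ?lt.
- rewrite nth_uniq ?lt ?enum_uniq // => /eqP h.
  have := congr1 (nth i (enum I)) h.
  by rewrite !nth_index ?mem_enum.
have jl : index j (enum J) < size (enum I) by rewrite IJ index_mem mem_enum.
have [i0 _] : exists i0 : T, i0 \in I.
  by case: (enum I) jl (mem_enum I) => // i0 s _ h; exists i0;
    rewrite -h mem_head.
exists (nth i0 (enum I) (index j (enum J))); first by rewrite -mem_enum mem_nth.
by rewrite index_uniq ?enum_uniq // nth_index ?mem_enum.
Qed.

Section Partition.
Variables n k : nat.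
Hypothesis nk : n./2 <= k.
Implicit Types A B C J : {set 'I_n}.

Definition level_sets : {set {set 'I_n}} :=
  [set B : {set 'I_n} | (k <= #|B|) && (odd #|B| == odd k)].

Definition odd_sets A : {set {set 'I_n}} :=
  [set C : {set 'I_n} | [&& C \subset A, k < #|C| & odd #|C| != odd k]].

(** The variables of the piece of [B]: those that do not lead from [B] to a set matched with [B]. *)
Definition free_dirs (f : {set 'I_n} -> {set 'I_n}) B : {set 'I_n} :=
  ~: [set t | (t \notin B) && (f (t |: B) == B)].

Lemma setU1_inj B (t u : 'I_n) : t \notin B -> t |: B = u |: B -> t = u.
Proof.
move=> tB h; have := setU11 t B; rewrite h !inE (negPf tB) orbF.
by move/eqP.
Qed.

(** Toggling [p] sends the odd sets injectively to even ones of size at least [k]. An even set is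
    missed exactly if toggling it would give size [k - 1], that is, if it has size [k] and contains
    [p]. *)
Lemma card_toggle A p : p \in A ->
  #|[set J : {set 'I_n} | [&& J \subset A, #|J| == k & p \in J]]| +
  #|odd_sets A| =
  #|[set B in level_sets | B \subset A]|.
Proof.
move=> pA; set JJ := (X in #|pred_of_set X| + _);
  set Ev := (X in _ = #|pred_of_set X|).
set Od := odd_sets A.
pose g C := if p \in C then C :\ p else p |: C.
have gg C : g (g C) = C.
  rewrite /g; case: (boolP (p \in C)) => pC; rewrite !inE eqxx /=.
    by rewrite setD1K.
  by rewrite setU1K.
rewrite -(card_imset (mem Od) (can_inj gg)).
have gOd : g @: Od = Ev :\: JJ.
  apply/setP=> B; apply/imsetP/idP => [[C CO ->]|].
    move: CO; rewrite !inE /g => /and3P[CA kC oC].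
    case: (boolP (p \in C)) => pC.
      have cC := cardsD1 p C; rewrite pC in cC.
      rewrite !inE eqxx /= !andbF /= (subset_trans (subD1set _ _) CA) andbT.
      by move: cC kC oC; move: #|C| #|C :\ p|; lia.
    rewrite !inE cardsU1 pC eqxx /= andbT subUset sub1set pA CA /=.
    by move: kC oC; move: #|C|; lia.
  rewrite !inE => /andP[BJ /andP[/andP[kB oB] BA]].
  exists (g B); rewrite ?gg // /g !inE; case: (boolP (p \in B)) => pB.
    have cB := cardsD1 p B; rewrite pB in cB.
    rewrite (subset_trans (subD1set _ _) BA) /=.
    by move: BJ cB kB oB; rewrite BA pB; move: #|B| #|B :\ p|; lia.
  rewrite cardsU1 pB subUset sub1set pA BA /=.
  by move: kB oB; move: #|B|; lia.
rewrite gOd cardsD (setIidPr _); first rewrite subnKC ?subset_leq_card //.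
all: apply/subsetP=> J; rewrite !inE => /and3P[-> /eqP -> _];
  by rewrite leqnn eqxx.
Qed.

(** The matching sends the odd subsets of [A] injectively to even ones. An even [B] is hit exactly
    if some [t] in [A] is the omitted variable of [B], that is, if [A] is not contained in
    [free_dirs f B]. *)
Lemma card_matching f A :
  (forall C, n < #|C|.*2 -> exists2 t, t \in C & f C = C :\ t) ->
  (forall C D : {set 'I_n}, n < #|C|.*2 -> n < #|D|.*2 -> f C = f D -> C = D) ->
  #|[set B in level_sets | (B \subset A) && (A \subset free_dirs f B)]| +
  #|odd_sets A| =
  #|[set B in level_sets | B \subset A]|.
Proof.
move=> fP finj; set Od := odd_sets A.
set II := (X in #|pred_of_set X| + _); set Ev := (X in _ = #|pred_of_set X|).
(* Here [n./2 <= k] ensures that all the sets above size [k] are matched. *)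
have big C : k < #|C| -> n < #|C|.*2 by move: nk; lia.
rewrite -(card_in_imset (f := f) (D := mem Od)); last first.
  move=> C D; rewrite !inE => /and3P[_ /big h _] /and3P[_ /big h' _].
  exact: finj.
have fOd : f @: Od = Ev :\: II.
  apply/setP=> B; apply/imsetP/idP => [[C CO ->]|].
    move: CO; rewrite !inE => /and3P[CA kC oC].
    have [t tC fC] := fP _ (big _ kC).
    have cC := cardsD1 t C; rewrite tC in cC.
    have BA : f C \subset A by rewrite fC (subset_trans (subD1set _ _) CA).
    rewrite BA /= andbT; apply/andP; split; last first.
      by rewrite fC; move: cC kC oC; move: #|C| #|C :\ t|; lia.
    rewrite negb_and; apply/orP; right; apply/subsetPn; exists t.
      exact: (subsetP CA).
    by rewrite !inE {1}fC !inE eqxx /= {1}fC setD1K // eqxx.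
  rewrite !inE => /andP[+ /andP[/andP[kB oB] BA]].
  rewrite kB oB BA /= => /subsetPn[t tA];
    rewrite !inE negbK => /andP[tB /eqP ft].
  exists (t |: B) => //; rewrite !inE cardsU1 tB subUset sub1set tA BA /=.
  by move: kB oB; move: #|B|; lia.
rewrite fOd cardsD (setIidPr _); first rewrite subnKC ?subset_leq_card //.
all: apply/subsetP=> J; rewrite !inE => /and3P[/andP[-> ->] -> _]; by [].
Qed.

(** Two omitted variables would give two sets with the same image [B] under [f]. *)
Lemma free_dirs_card f B :
  (forall C D : {set 'I_n}, n < #|C|.*2 -> n < #|D|.*2 -> f C = f D -> C = D) ->
  k <= #|B| -> n - 1 <= #|free_dirs f B|.
Proof.
move=> finj kB; rewrite /free_dirs cardsCs setCK card_ord leq_sub2l //.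
apply/card_le1P=> t; rewrite !inE => /andP[tB /eqP ft] u; rewrite !inE.
apply/andP/eqP=> [[uB /eqP fu]|->]; last by rewrite tB ft.
apply: (setU1_inj uB); apply: finj; last by rewrite ft.
  by rewrite cardsU1 uB; move: kB nk; lia.
by rewrite cardsU1 tB; move: kB nk; lia.
Qed.

(** Piece [i] meets the multidegrees whose support [A] lies between [B i] and [Z i]. For each [A],
    the map [b A] is a bijection from the pieces that meet it to the basis sets [J]; both sides have
    the same size because adding [odd_sets A] to either gives the even subsets of [A]. *)
Lemma hilbert_partition (p : {set 'I_n} -> 'I_n) : 0 < k ->
  (forall A, A != set0 -> p A \in A) ->
  exists m (B Z : 'I_m -> {set 'I_n}) (b : {set 'I_n} -> 'I_m -> {set 'I_n}),
  [/\ forall i, B i \subset Z i /\ n - 1 <= #|Z i|,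
      forall A i, B i \subset A -> A \subset Z i ->
        [/\ b A i \subset A, #|b A i| = k & p A \in b A i],
      forall A i i', B i \subset A -> A \subset Z i ->
        B i' \subset A -> A \subset Z i' -> b A i = b A i' -> i = i' &
      forall A J, J \subset A -> #|J| = k -> p A \in J ->
        exists i, [/\ B i \subset A, A \subset Z i & b A i = J]].
Proof.
move=> k0 pP; have [f [fP finj]] := shadow_matching n.
pose m := #|level_sets|; pose B (i : 'I_m) : {set 'I_n} := enum_val i.
pose Z i := free_dirs f (B i).
pose I A := [set i | (B i \subset A) && (A \subset Z i)].
pose JJ A := [set J : {set 'I_n} | [&& J \subset A, #|J| == k & p A \in J]].
have BP i : k <= #|B i| by have := enum_valP i; rewrite inE => /andP[].
have cardIJ A : #|I A| = #|JJ A|.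
  (* For empty [A] there is no [p A] in [A] to toggle, but both sides are empty since [k] is
     positive. *)
  have [->|A0] := eqVneq A set0.
    transitivity 0; [|symmetry]; apply/eqP; rewrite cards_eq0; apply/eqP/setP.
      move=> i; rewrite !inE subset0; apply/negbTE/nandP; left;
        rewrite -card_gt0.
      exact: leq_trans (BP i).
    move=> J; rewrite !inE subset0; case: eqP => // ->; rewrite cards0.
    by move: k0; case: (k).
  have <- : #|[set C in level_sets | (C \subset A) && (A \subset free_dirs f
    C)]| = #|I A|.
    rewrite -(card_imset (mem (I A)) enum_val_inj); congr #|pred_of_set _|.
    apply/setP=> C; apply/idP/imsetP => [|[i iI ->]].
      rewrite inE => /andP[CP h]; exists (enum_rank_in CP C).
        by rewrite inE /Z /B enum_rankK_in.
      by rewrite enum_rankK_in.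
    by move: iI; rewrite !inE => ->; have := enum_valP i; rewrite inE => ->.
  apply/eqP; rewrite -(eqn_add2r #|odd_sets A|).
  by rewrite card_matching // card_toggle // pP.
have [b bP] := fin_all_exists (fun A => equal_card_bijection set0 (cardIJ A)).
exists m, B, Z, b; split.
- move=> i; split; last exact: free_dirs_card (BP i).
  by apply/subsetP=> t tB; rewrite !inE tB.
- move=> A i BA AZ; have [h _ _] := bP A.
  by have := h i; rewrite !inE BA AZ => /(_ isT)/and3P[? /eqP].
- move=> A i i' BA AZ BA' AZ'; have [_ h _] := bP A.
  by apply: h; rewrite inE ?BA ?BA'.
move=> A J JA Jk pJ; have [_ _ h] := bP A.
have [|i] := h J; first by rewrite inE JA Jk pJ eqxx.
by rewrite inE => /andP[BA AZ] bJ; exists i.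
Qed.

End Partition.

(** * The lower bound *)

Section Restriction.
Local Open Scope ring_scope.
Variables (K : fieldType) (n : nat).
Local Notation R := {mpoly K[n]}.
Implicit Types (Z Y : {set 'I_n}) (f g : R).

(** The retraction of [R] onto the polynomial ring in the variables of [Z]; that subring is
    represented below by the fixed points of [restr Z]. *)
Definition restr Z f : R := f \mPo [tuple if i \in Z then 'X_i else 0 | i < n].

Lemma restrX Z (m : 'X_{1..n}) :
  restr Z 'X_[m] = if mnm_supp m \subset Z then 'X_[m] else 0.
Proof.
rewrite /restr comp_mpolyX; case: ifPn => [mZ|/subsetPn[i]].
  rewrite [RHS]mpolyXE_id; apply: eq_bigr => i _; rewrite tnth_mktuple.
  have [//|iZ] := ifPn; rewrite (_ : m i = 0%N) ?expr0 //.
  by apply/eqP; rewrite -leqn0 leqNgt; apply: contra iZ => mi;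
    rewrite (subsetP mZ) // inE.
rewrite inE => mi iZ; apply/eqP/prodf_eq0; exists i => //.
by rewrite tnth_mktuple (negPf iZ) expf_eq0 mi eqxx.
Qed.

Lemma mcoeff_restr Z f (m : 'X_{1..n}) :
  (restr Z f)@_m = if mnm_supp m \subset Z then f@_m else 0.
Proof.
have -> : restr Z f = \sum_(l <- msupp f) f@_l *: restr Z 'X_[l].
  by rewrite {1}[f]mpolyE /restr linear_sum; apply: eq_bigr => l _;
    rewrite linearZ.
rewrite raddf_sum /=; case: ifPn => mZ.
  rewrite [in RHS](mpolyE f) raddf_sum; apply: eq_bigr => l _ /=.
  rewrite !mcoeffZ restrX mcoeffX; case: (l =P m) => [->|lm].
    by rewrite mZ mcoeffX eqxx.
  by case: ifP; rewrite ?mcoeffX ?mcoeff0 ?(introF eqP lm).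
rewrite big1 // => l _; rewrite mcoeffZ restrX.
case: ifPn => lZ; rewrite ?mcoeff0 ?mulr0 // mcoeffX.
by case: eqP mZ => [<-|_ _]; rewrite ?lZ ?mulr0.
Qed.

Lemma restr_comp Z Y f : restr Z (restr Y f) = restr (Z :&: Y) f.
Proof.
by apply/mpolyP=> m; rewrite !mcoeff_restr subsetI; case: ifP.
Qed.

Lemma restr_supp Z f (m : 'X_{1..n}) :
  restr Z f = f -> f@_m != 0 -> mnm_supp m \subset Z.
Proof. by move=> <-; rewrite mcoeff_restr; case: ifP; rewrite ?eqxx. Qed.

Lemma mcoeff_hcomp (G : zmodType) (w : 'I_n -> G) d f m :
  (hcomp w d f)@_m = if mdegw w m == d then f@_m else 0.
Proof.
rewrite /hcomp big_mkcond raddf_sum /=.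
have [mf|mf] := boolP (m \in msupp f); last first.
  rewrite (memN_msupp_eq0 mf) if_same big_seq big1 // => l lf.
  case: ifP => _; rewrite ?mcoeff0 // mcoeffZ mcoeffX.
  by case: eqP => [lm|_]; rewrite ?mulr0 // -lm lf in mf *.
rewrite (bigD1_seq m) //= big1 ?addr0 => [|l /negPf lm].
  by case: ifP; rewrite ?mcoeff0 // mcoeffZ mcoeffX eqxx mulr1.
by case: ifP; rewrite ?mcoeff0 // mcoeffZ mcoeffX lm mulr0.
Qed.

Lemma restr_graded_retract (G : zmodType) (w : 'I_n -> G) Z :
  graded_retract w (fun f : R => restr Z f = f).
Proof.
split.
  split.
  - exact: comp_mpoly1.
  - by move=> f g fZ gZ;
    rewrite /restr linearD /= -/(restr Z f) fZ -/(restr Z g) gZ.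
  - by move=> f g fZ gZ;
    rewrite /restr rmorphM /= -/(restr Z f) fZ -/(restr Z g) gZ.
  - by move=> c f fZ; rewrite /restr linearZ /= -/(restr Z f) fZ.
  move=> d f fZ; apply/mpolyP=> m; rewrite mcoeff_restr !mcoeff_hcomp -{2}fZ.
  by rewrite mcoeff_restr; do 2 case: ifP.
have idem f : restr Z (restr Z f) = restr Z f by rewrite restr_comp setIid.
exists (restr Z); split; first split.
- by move=> f g; rewrite /restr linearD.
- by move=> f g; rewrite /restr rmorphM.
- by move=> c f; rewrite /restr linearZ.
- exact: comp_mpoly1.
split=> [d f fd m|]; last by split=> // s sZ; exists s.
rewrite mcoeff_msupp mcoeff_restr; case: ifP => [_|]; last by rewrite eqxx.
by rewrite -mcoeff_msupp; apply: fd.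
Qed.

(** The chain consists of the primes generated by the first [j] variables of [Z], written as kernels
    of the restriction to the remaining ones, [Y j]. *)
Lemma restr_krull_dim Z d : (d <= #|Z|)%N ->
  krull_dim_ge (fun f : R => restr Z f = f) d.
Proof.
move=> dZ; pose Y j := [set z in drop j (enum Z)].
have YZ j : Y j \subset Z.
  by apply/subsetP=> z; rewrite inE => /mem_drop; rewrite mem_enum.
have rM W f g : restr W (f * g) = restr W f * restr W g by rewrite /restr
  rmorphM.
have rD W f g : restr W (f + g) = restr W f + restr W g by rewrite /restr
  linearD.
exists (fun j f => restr Z f = f /\ restr (Y j) f = 0); split.
  move=> j _; split; first split.
  - by move=> f [].
  - by rewrite /restr !linear0.
  - by move=> f g [fZ fY] [gZ gY]; rewrite !rD fZ gZ fY gY addr0.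
  - by move=> s f sZ [fZ fY]; rewrite !rM sZ fZ fY mulr0.
  - by rewrite /restr !comp_mpoly1 => -[_ /eqP]; rewrite oner_eq0.
  move=> f g fZ gZ [_ /eqP]; rewrite rM mulf_eq0.
  by case/orP=> /eqP h; [left|right].
move=> j jd; split=> [f [fZ fY]|].
  split=> //; apply/mpolyP=> m; rewrite mcoeff_restr mcoeff0.
  case: ifP => // mY; have := congr1 (mcoeff m) fY.
  rewrite mcoeff_restr mcoeff0 (subset_trans mY) //.
  apply/subsetP=> z; rewrite !inE -addn1 addnC -drop_drop; exact: mem_drop.
have jZ : (j < size (enum Z))%N by rewrite -cardE; apply: leq_trans dZ.
have [z0 _] : exists z0 : 'I_n, z0 \in enum Z.
  by case: (enum Z) jZ => // z0 s _; exists z0; rewrite mem_head.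
pose z := nth z0 (enum Z) j.
have dropE : drop j (enum Z) = z :: drop j.+1 (enum Z) by rewrite (drop_nth z0).
have suppz : mnm_supp U_(z)%MM = [set z].
  by apply/setP=> i; rewrite !inE mnm1E lt0b eq_sym.
exists 'X_z; rewrite !restrX suppz !sub1set !inE; split; last first.
  move=> [_]; rewrite dropE mem_head => /eqP.
  by rewrite -msupp_eq0 msuppX.
rewrite -mem_enum mem_nth //; split=> //.
have := drop_uniq j (enum_uniq (mem Z)); rewrite dropE /=.
by case/andP=> /negPf ->.
Qed.

End Restriction.

(** * Linear maps given by their values on monomials *)

Section LinearExtension.
Local Open Scope ring_scope.
Variables (K : fieldType) (n : nat) (V : lmodType K).
Local Notation R := {mpoly K[n]}.

Definition lin_ext (T : 'X_{1..n} -> V) (f : R) : V :=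
  \sum_(m <- msupp f) f@_m *: T m.

(** The support varies with [f]; a common index set of monomials is what makes linearity a termwise
    check. *)
Lemma lin_extE T f d : (msize f <= d)%N ->
  lin_ext T f = \sum_(m : 'X_{1..n < d}) f@_m *: T m.
Proof.
move=> fd; pose s := [seq bmnm m | m <- enum (mem {: 'X_{1..n < d}})].
have us : uniq s by rewrite map_inj_uniq ?enum_uniq //; apply: val_inj.
have sub : {subset msupp f <= s}.
  move=> m /msize_mdeg_lt mf; have md := leq_trans mf fd.
  by apply/mapP; exists (BMultinom md); rewrite ?mem_enum.
have -> : \sum_(m : 'X_{1..n < d}) f@_m *: T m = \sum_(m <- s) f@_m *: T m.
  by rewrite big_map big_enum.
rewrite (bigID (mem (msupp f)) predT) /= [X in _ + X]big1 ?addr0; last first.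
  by move=> m /memN_msupp_eq0 ->; rewrite scale0r.
rewrite -big_filter; apply: perm_big; apply: uniq_perm.
- exact: msupp_uniq.
- exact: filter_uniq.
by move=> m; rewrite mem_filter; case: (boolP (m \in msupp f)) => //= /sub ->.
Qed.

Lemma lin_extP T c f g : lin_ext T (c *: f + g) = c *: lin_ext T f + lin_ext T
  g.
Proof.
pose d := maxn (msize (c *: f + g)) (maxn (msize f) (msize g)).
rewrite !(@lin_extE _ _ d) /d ?leq_maxr ?leq_maxl //; last first.
- by rewrite !leq_max leqnn !orbT.
- by rewrite !leq_max leqnn !orbT.
rewrite scaler_sumr -big_split; apply: eq_bigr => m _.
by rewrite mcoeffD mcoeffZ scalerDl scalerA.
Qed.

Lemma lin_extX T m : lin_ext T 'X_[m] = T m.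
Proof. by rewrite /lin_ext msuppX big_seq1 mcoeffX eqxx scale1r. Qed.

Lemma lin_ext0 T : lin_ext T 0 = 0.
Proof. by rewrite /lin_ext msupp0 big_nil. Qed.

End LinearExtension.

(** * Degrees in a general grading *)

Section Weights.
Local Open Scope ring_scope.
Variables (K : fieldType) (n : nat) (G : zmodType) (w : 'I_n -> G).

Lemma mdegwD (a m : 'X_{1..n}) : mdegw w (a + m)%MM = mdegw w a + mdegw w m.
Proof. by rewrite -big_split; apply: eq_bigr => i _; rewrite mnmDE mulrnDr. Qed.

Lemma mdegw_mesym1 J : mdegw w (mesym1 J) = basis_deg w J.
Proof.
rewrite /basis_deg big_mkcond; apply: eq_bigr => i _; rewrite mnm_mesym1E.
by case: (i \in J).
Qed.

Lemma homog_ext_sum (I : Type) (r : seq I) (P : pred I) d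
    (F : I -> {ffun {set 'I_n} -> {mpoly K[n]}}) :
  (forall i, P i -> homog_ext w d (F i)) ->
  homog_ext w d (\sum_(i <- r | P i) F i).
Proof.
move=> h; apply: (big_ind (homog_ext w d)) => // [J m|F1 F2 h1 h2 J m].
  by rewrite ffunE msupp0.
by rewrite ffunE => /msuppD_le; rewrite mem_cat => /orP[/h1|/h2].
Qed.

Lemma homog_extZ d c (F : {ffun {set 'I_n} -> {mpoly K[n]}}) :
  homog_ext w d F -> homog_ext w d (c *: F).
Proof. by move=> h J m; rewrite ffunE => /msuppZ_le; apply: h. Qed.

End Weights.

(** * A Hilbert decomposition of depth n - 1 *)

Section LowerBound.
Local Open Scope ring_scope.
Variables (K : fieldType) (n k : nat) (G : zmodType) (w : 'I_n -> G).
Hypotheses (k0 : (0 < k)%N) (nk : (n./2 <= k)%N) (kn : (k < n)%N).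
Local Notation R := {mpoly K[n]}.
Local Notation E := {ffun {set 'I_n} -> R}.

Lemma syz_Hdepth_ge : Hdepth_ge w (@syz_module K n k) (n - 1).
Proof.
have n0 : (0 < n)%N by apply: leq_ltn_trans kn.
pose p (A : {set 'I_n}) := odflt (Ordinal n0) [pick i in A].
have pP A : A != set0 -> p A \in A.
  rewrite /p; case: pickP => [i|h] //= /set0Pn[i iA].
  by have := h i; rewrite /= iA.
have [N [B [Z [b [BZ bP binj bsurj]]]]] := hilbert_partition nk k0 pP.
(* The monomial [m] of piece [i] sits in multidegree [a = m + e_(B i)] and is sent to the basis
   element that [b] assigns to [i] for the support of [a]. *)
pose T i m : E := kgen K (m + mesym1 (B i))%MM (b (mnm_supp (m + mesym1 (B
  i))%MM) i).
pose Phi (x : 'I_N -> R) : E := \sum_i lin_ext (T i) (x i).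
pose ok i (m : 'X_{1..n}) := mnm_supp m \subset Z i.
have okP i m : ok i m -> let A := mnm_supp (m + mesym1 (B i))%MM in
    B i \subset A /\ A \subset Z i.
  move=> mZ A; rewrite /A mnm_suppD mnm_supp_mesym1 subsetUr; split=> //.
  by rewrite subUset; apply/andP; split=> //; have [] := BZ i.
have okB i a : B i \subset mnm_supp a -> mnm_supp a \subset Z i ->
    ok i (a - mesym1 (B i))%MM /\ (a - mesym1 (B i) + mesym1 (B i))%MM = a.
  rewrite -mesym1_le => Ba aZ; rewrite submK //; split=> //.
  apply: subset_trans aZ; apply/subsetP=> j; rewrite !inE mnmBE.
  by move/leq_trans; apply; apply: leq_subr.
have okS (x : 'I_N -> R) i m :
    (forall i, restr (Z i) (x i) = x i) -> m \in msupp (x i) -> ok i m.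
  by move=> xS; rewrite mcoeff_msupp; apply: restr_supp.
have PhiP c x y : Phi (fun i => c *: x i + y i) = c *: Phi x + Phi y.
  rewrite /Phi scaler_sumr -big_split; apply: eq_bigr => i _.
  by rewrite lin_extP.
have PhiE i m : Phi (fun j => if j == i then 'X_[m] else 0) = T i m.
  rewrite /Phi (bigD1 i) //= eqxx lin_extX big1 ?addr0 // => j /negPf ->.
  exact: lin_ext0.
exists N, (fun i f => restr (Z i) f = f), (fun i => basis_deg w (B i)); split.
- by move=> i; apply: restr_graded_retract.
- exists Phi; split.
  + by move=> c x y J; rewrite PhiP !ffunE.
  + move=> x xS; apply: syz_sum => i _; rewrite /lin_ext big_seq.
    apply: syz_sum => m mx; rewrite -[_ *: _]addr0.
    apply: syz_linear; last exact: syz0.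
    have [BA AZ] := okP _ _ (okS _ _ _ xS mx).
    by apply: syz_kgen; have [] := bP _ _ BA AZ.
  (* Injectivity: among the images of all monomials of all pieces, only that of [m] in piece [i] has
     a nonzero coefficient at [X^(a - e_L) e_L], where [L] is [J] without [p]. So this coefficient
     recovers that of [m] in [x i]. *)
  + have coefPhi x i m : (forall i, restr (Z i) (x i) = x i) -> ok i m ->
      let a := (m + mesym1 (B i))%MM in let J := b (mnm_supp a) i in
      let L := J :\ p (mnm_supp a) in
      (Phi x L)@_(a - mesym1 L)%MM = (x i)@_m * kcoef K J L.
      move=> xS mok a J L; have [BA AZ] := okP _ _ mok; rewrite -/a in BA AZ.
      have [JA _ pJ] := bP _ _ BA AZ; rewrite -/J in JA pJ.
      have coefT i' m' : ok i' m' -> (T i' m' L)@_(a - mesym1 L)%MM =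
          (if (i' == i) && (m' == m) then kcoef K J L else 0).
        move=> /okP[BA' AZ']; have [JA' _ pJ'] := bP _ _ BA' AZ'.
        rewrite /T kgenE // mcoeffZ mcoeffX.
        set a' := (m' + _)%MM in BA' AZ' JA' pJ' *;
          set J' := b _ i' in JA' pJ' *.
        case: ifPn => [/andP[/eqP ii /eqP mm]|].
          have aa : a' = a by rewrite /a' ii mm.
          by rewrite aa eqxx mulr1 /J' aa ii.
        apply: contraNeq; rewrite mulf_eq0 negb_or => /andP[/kcoef_neq0[q qJ
          LE]].
        case: ((a' - mesym1 L)%MM =P _) => [aa _|]; last by rewrite eqxx.
        have LA : L \subset mnm_supp a by apply: subset_trans JA;
          apply: subD1set.
        have LA' : L \subset mnm_supp a' by rewrite LE (subset_trans _ JA') //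
          subD1set.
        have {}aa : a' = a.
          by rewrite -(@submK _ (mesym1 L) a') ?mesym1_le // aa submK //
            mesym1_le.
        (* [L] misses [p] but [J'] contains it, so the element [q] removed from [J'] is [p], and
           [J' = J]. *)
        have pq : p (mnm_supp a) = q.
          apply/eqP; apply: contraT => pq; rewrite -/J' -aa in pJ' pq.
          have : p (mnm_supp a') \in L by rewrite LE !inE pq.
          by rewrite /L aa !inE eqxx.
        have JJ : J' = J by rewrite -(setD1K qJ) -LE -pq setD1K.
        have ii : i' = i.
          by rewrite aa in BA' AZ'; apply: (binj _ _ _ BA' AZ' BA AZ);
            rewrite -/J -JJ /J' aa.
        rewrite ii eqxx /=; apply/eqP/(@addIm _ (mesym1 (B i))).
        by rewrite -/a -aa /a' ii.
      rewrite /Phi sum_ffunE raddf_sum /= (bigD1 i) //= [X in _ + X]big1 ?addr0.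
        rewrite /lin_ext sum_ffunE raddf_sum /= big_seq.
        under eq_bigr => m' m'x do
          rewrite ffunE mcoeffZ coefT ?(okS _ _ _ xS m'x) // eqxx /=.
        rewrite -big_seq; have [mx|mx] := boolP (m \in msupp (x i)).
          rewrite (bigD1_seq m) //= eqxx big1 ?addr0 // => m' /negPf ->.
          by rewrite mulr0.
        rewrite (memN_msupp_eq0 mx) mul0r big_seq big1 // => m' m'x.
        by case: eqP => [mm|]; rewrite ?mulr0 // -mm m'x in mx *.
      move=> i' /negPf ii; rewrite /lin_ext sum_ffunE raddf_sum /= big_seq big1
        //.
      by move=> m' m'x; rewrite ffunE mcoeffZ coefT ?(okS _ _ _ xS m'x) // ii
        mulr0.
    move=> x y xS yS xy; apply: functional_extensionality => i.
    apply/mpolyP=> m; have [mok|mok] := boolP (ok i m); last first.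
      by rewrite -(xS i) -(yS i) !mcoeff_restr -!/(ok i m) (negPf mok).
    have := coefPhi x i m xS mok; rewrite /= xy coefPhi // => /esym/mulIf;
      apply.
    have [BA AZ] := okP _ _ mok; have [_ _ pJ] := bP _ _ BA AZ.
    exact: kcoefD1_neq0.
  + pose Im F := exists2 x, (forall i, restr (Z i) (x i) = x i) & Phi x = F.
    rewrite -/(Im _); have Im0 : Im 0.
      exists (fun=> 0) => [i|]; first by rewrite /restr linear0.
      by rewrite /Phi big1 // => i _; apply: lin_ext0.
    have ImP c F1 F2 : Im F1 -> Im F2 -> Im (c *: F1 + F2).
      move=> [x xS <-] [y yS <-]; exists (fun i => c *: x i + y i) => // i.
      by rewrite /restr linearP /= -!/(restr _ _) xS yS.
    apply: syz_ind => // a J Ja Jk.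
    have Imp (L : {set 'I_n}) : L \subset mnm_supp a -> #|L| = k ->
        p (mnm_supp a) \in L -> Im (kgen K a L).
      move=> La Lk pL; have [i [BA AZ bL]] := bsurj _ _ La Lk pL.
      have [mok ma] := okB _ _ BA AZ.
      exists (fun j => if j == i then 'X_[a - mesym1 (B i)] else 0).
        move=> j; case: eqP => [->|_]; last by rewrite /restr linear0.
        by rewrite restrX -/(ok _ _) mok.
      by rewrite PhiE /T ma bL.
    have [pJ|pJ] := boolP (p (mnm_supp a) \in J); first exact: Imp.
    have pa : p (mnm_supp a) \in mnm_supp a.
      apply: pP; apply: contraTneq k0 => a0; move: Ja.
      by rewrite a0 subset0 => /eqP J0; rewrite -Jk J0 cards0.
    (* If [J] misses [p], the relation for [C] expresses [kgen a J] by the other subsets of [C] of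
       size [k]; all of them contain [p]. *)
    set C := p (mnm_supp a) |: J.
    have CJ : C :\ p (mnm_supp a) = J by rewrite setU1K.
    have Ca : C \subset mnm_supp a by rewrite subUset sub1set pa.
    have CJ0 : kcoef K C J != 0 by rewrite -CJ kcoefD1_neq0 ?setU11.
    have := kgen_relation K Ca; rewrite (bigD1 J) //= => /eqP; rewrite addr_eq0.
    move/eqP/(congr1 (fun F : E => (kcoef K C J)^-1 *: F)).
    rewrite scalerA mulVf // scale1r => ->.
    rewrite scalerN -scaleNr -[_ *: _]addr0; apply: (ImP) => //.
    apply: (big_ind Im) => // [F1 F2 h1 h2|L LJ].
      by rewrite -[F1]scale1r; apply: (ImP).
    have [->|/kcoef_neq0[q qC LE]] := eqVneq (kcoef K C L) 0.
      by rewrite scale0r.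
    have pq : p (mnm_supp a) != q by apply: contraNneq LJ => pq;
      rewrite LE -pq CJ.
    rewrite -[_ *: _]addr0; apply: (ImP) => //; apply: Imp.
    * by rewrite LE (subset_trans _ Ca) // subD1set.
    * by have := cardsD1 q C; rewrite qC -LE /C cardsU1 pJ Jk; lia.
    * by rewrite LE !inE pq eqxx.
  move=> d x xS; apply: homog_ext_sum => i _; rewrite /lin_ext big_seq.
  apply: homog_ext_sum => m mx; apply: homog_extZ => L l.
  have [BA AZ] := okP _ _ (okS _ _ _ (fun i => (xS i).1) mx).
  have [JA _ _] := bP _ _ BA AZ; move/(kgen_homog JA)/(congr1 (mdegw w)).
  rewrite !mdegwD !mdegw_mesym1 => ->.
  by rewrite ((xS i).2 _ mx) subrK.
by move=> i; apply: restr_krull_dim; have [] := BZ i.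
Qed.

End LowerBound.

(** * The upper bound *)

Section UpperBound.
Local Open Scope ring_scope.
Variables (K : fieldType) (n k : nat) (G : zmodType) (w : 'I_n -> G).
Variable sigma : {additive G -> int}.
Hypotheses (k0 : (0 < k)%N) (kn : (k < n)%N) (sigma1 : forall i, sigma (w i) =
  1).
Local Notation R := {mpoly K[n]}.
Local Notation E := {ffun {set 'I_n} -> R}.

(** Through [sigma], every grading considered is compared with the standard one, so one argument
    serves both. *)
Lemma sigma_mdegw (m : 'X_{1..n}) : sigma (mdegw w m) = (mdeg m)%:Z.
Proof.
rewrite raddf_sum mdegE (big_morph Posz PoszD (erefl _)).
by apply: eq_bigr => i _; rewrite raddfMn /= sigma1 -mulr_natr mul1r natz.
Qed.

Lemma sigma_basis_deg (J : {set 'I_n}) : sigma (basis_deg w J) = #|J|%:Z.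
Proof. by rewrite -mdegw_mesym1 sigma_mdegw mdeg_mesym1. Qed.

Lemma syz_deg_ge (F : E) (L : {set 'I_n}) (m : 'X_{1..n}) :
  @syz_module K n k F -> m \in msupp (F L) -> (k <= mdeg m + #|L|)%N.
Proof.
move=> MF; move: F MF L m.
apply: syz_ind => [L m|c F1 F2 h1 h2 L m|a J Ja Jk L m].
- by rewrite ffunE msupp0.
- rewrite !ffunE => /msuppD_le; rewrite mem_cat => /orP[/msuppZ_le/h1|/h2] //.
move/(kgen_homog Ja)/(congr1 (@mdeg n)); rewrite mdegD mdeg_mesym1 => ->.
move: Ja; rewrite -mesym1_le => /submK <-.
by rewrite mdegD mdeg_mesym1 Jk leq_addl.
Qed.

(** For a [k]-form, the part of the boundary in degree [k + 1] comes from its linear coefficients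
    alone. *)
Lemma koszul_diff_deg (D : E) (L : {set 'I_n}) (m : 'X_{1..n}) :
  (forall J : {set 'I_n}, #|J| != k -> D J = 0) ->
  (forall (J : {set 'I_n}) q, #|J| = k -> (D J)@_U_(q) = 0) ->
  (mdeg m + #|L| = k.+1)%N -> (koszul_diff D L)@_m = 0.
Proof.
move=> D0 D1 mL; rewrite koszul_diffE sum_ffunE raddf_sum big1 //= => J _.
have [Jk|/eqP/eqP/D0 ->] := eqVneq #|J| k;
  last by rewrite msupp0 big_nil ffunE mcoeff0.
rewrite sum_ffunE raddf_sum big1 //= => l _; rewrite ffunE mcoeffZ.
have [/mdeg1P[q /eqP ->]|l1] := boolP (mdeg l == 1%N);
  first by rewrite D1 ?mul0r.
rewrite [X in _ * X]memN_msupp_eq0 ?mulr0 //; apply: contra l1 => /kgen_homog h.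
have /h/(congr1 (@mdeg n)) : J \subset mnm_supp (l + mesym1 J)%MM.
  by rewrite mnm_suppD mnm_supp_mesym1 subsetUr.
rewrite !mdegD !mdeg_mesym1 mL Jk => e; apply/eqP; move: e; lia.
Qed.

(** The term [X_p e_(J :\ p)] occurs in the boundary of [e_I] only for [I = J]; thus these
    boundaries are linearly independent. *)
Lemma kgen_top_coef (I J : {set 'I_n}) (p : 'I_n) : p \in J ->
  (kgen K (mesym1 I) I (J :\ p))@_U_(p) = if I == J then kcoef K J (J :\ p)
    else 0.
Proof.
move=> pJ; rewrite kgenE ?mnm_supp_mesym1 // mcoeffZ mcoeffX.
have mesymD1 (A : {set 'I_n}) q : q \in A -> (mesym1 A - mesym1 (A :\ q))%MM =
  U_(q)%MM.
  by move=> qA; rewrite -{1}(setD1K qA) mesym1U1 ?addmK // !inE eqxx.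
case: (I =P J) => [->|IJ]; first by rewrite mesymD1 // eqxx mulr1.
apply/eqP; apply: contra_notT IJ; rewrite mulf_eq0 negb_or.
case/andP=> /kcoef_neq0[q qI JI]; rewrite JI mesymD1 //.
case: (U_(q)%MM =P _) => [/eqP|]; last by rewrite eqxx.
by rewrite eq_mnm1 => /eqP qp _; rewrite -(setD1K qI) -JI qp setD1K.
Qed.

Lemma syz_not_Hdepth_ge : ~ Hdepth_ge w (@syz_module K n k) n.
Proof.
move=> [N [S [s [ret [Phi [lin inM inj surj hom]] kr]]]].
have Sfull i f : S i f.
  have [_ [phi [[phiD phiM _ phi1] [_ [Sphi _ phiS]]]]] := ret i.
  exact: (retract_full phiD phiM phi1 Sphi phiS (kr i)).
have {}inM x : @syz_module K n k (Phi x) by apply: inM.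
have {}inj x y : Phi x = Phi y -> x = y by apply: inj.
have PhiP c x y : Phi (fun i => c *: x i + y i) = c *: Phi x + Phi y.
  by apply/ffunP=> J; rewrite lin !ffunE.
have Phi0 : Phi (fun=> 0) = 0.
  rewrite -[RHS](addNr (Phi (fun=> 0))) -scaleN1r -PhiP.
  by congr Phi; apply: functional_extensionality => i; rewrite scaler0 addr0.
have PhiZ c x : Phi (fun i => c *: x i) = c *: Phi x.
  rewrite -[RHS]addr0 -Phi0 -PhiP; congr Phi.
  by apply: functional_extensionality => i; rewrite addr0.
have Phi_sum (I : Type) (r : seq I) (y : I -> 'I_N -> R) :
    Phi (fun i => \sum_(a <- r) y a i) = \sum_(a <- r) Phi (y a).
  elim: r => [|a r IH].
    rewrite big_nil -[RHS]Phi0; congr Phi.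
    by apply: functional_extensionality => i; rewrite big_nil.
  rewrite big_cons -IH -[Phi (y a)]scale1r -PhiP; congr Phi.
  by apply: functional_extensionality => i; rewrite big_cons scale1r.
pose delta (i : 'I_N) (f : R) (j : 'I_N) : R := if j == i then f else 0.
(* [Phi] is determined by its values on single monomials in single pieces, whose degrees are
   known. *)
have PhiE x : Phi x = \sum_i lin_ext (fun m => Phi (delta i 'X_[m])) (x i).
  transitivity (Phi (fun j => \sum_i delta i (x i) j)).
    congr Phi; apply: functional_extensionality => j.
    rewrite (bigD1 j) //= /delta eqxx big1 ?addr0 // => i.
    by rewrite eq_sym => /negPf ->.
  rewrite Phi_sum; apply: eq_bigr => i _.
  transitivity (Phi (fun j => \sum_(m <- msupp (x i)) (x i)@_m *: delta i
    'X_[m] j)).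
    congr Phi; apply: functional_extensionality => j; rewrite /delta.
    case: (j == i); first by rewrite -mpolyE.
    by rewrite big1 // => m _; rewrite scaler0.
  by rewrite Phi_sum; apply: eq_bigr => m _; rewrite PhiZ.
pose t i := sigma (s i).
have Phi_deg i m L l : l \in msupp (Phi (delta i 'X_[m]) L) ->
    (mdeg l + #|L|)%:Z = t i + (mdeg m)%:Z.
  move=> lP; rewrite PoszD -sigma_mdegw -sigma_basis_deg -raddfD.
  rewrite -sigma_mdegw /t -raddfD; congr (sigma _).
  apply: hom lP => j; split=> // m'; rewrite /delta; case: eqP => [->|_].
    by move/mem_msuppXP => <-; rewrite [s i + _]addrC addrK.
  by rewrite msupp0.
(* The image of the unit of piece [i] is nonzero of degree [t i], and the module lives in degrees at
   least [k]. *)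
have t_ge i : (k%:Z <= t i)%R.
  have /eqP/eqP nz : Phi (delta i 'X_[0]) != 0.
    apply/eqP; rewrite -Phi0 => /inj/(congr1 (fun x => x i)).
    by rewrite /delta eqxx => /eqP; rewrite mpolyX0 oner_eq0.
  have [L nzL] : exists L, Phi (delta i 'X_[0]) L != 0.
    apply/existsP; apply: contraNT nz => /existsPn h.
    by apply/eqP/ffunP=> L; have := h L; rewrite negbK ffunE => /eqP.
  have := mlead_supp nzL; set l := mlead _ => lP.
  have := Phi_deg _ _ _ _ lP; rewrite mdeg0 addr0 => <-.
  exact: (syz_deg_ge (inM _) lP).
have [x xP] : exists x : {set 'I_n} -> 'I_N -> R,
    forall J : {set 'I_n}, #|J| = k -> Phi (x J) = kgen K (mesym1 J) J.
  apply: (fin_all_exists (P := fun (J : {set 'I_n}) x => #|J| = k -> Phi x =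
    kgen K (mesym1 J) J)) => J.
  have [Jk|Jk] := eqVneq #|J| k; last by exists (fun=> 0) => /eqP;
    rewrite (negPf Jk).
  by have [y _ yP] := surj _ (syz_kgen K (mesym1 J) Jk); exists y.
(* The degree [k] part of the preimage [x J] of the boundary of [e_J]: the constant terms in the
   pieces that start in degree [k]. *)
pose y J i := if t i == k%:Z then (x J i)@_0%MM else 0.
(* The families [y J] inherit the linear independence of the boundaries of the [e_J]. *)
have ycoef (I J : {set 'I_n}) p : #|I| = k -> #|J| = k -> p \in J ->
    \sum_i y I i * (Phi (delta i 'X_[0]) (J :\ p))@_U_(p) =
    if I == J then kcoef K J (J :\ p) else 0.
  move=> Ik Jk pJ; rewrite -kgen_top_coef // -xP // PhiE sum_ffunE raddf_sum.
  apply: eq_bigr => i _ /=; rewrite /lin_ext sum_ffunE raddf_sum /=.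
  have zero m : (t i != k%:Z) || (m != 0%MM) ->
      (Phi (delta i 'X_[m]) (J :\ p))@_U_(p) = 0.
    move=> h; apply: memN_msupp_eq0; apply/negP=> /Phi_deg; rewrite mdeg1.
    have := cardsD1 p J; rewrite pJ Jk => kE; rewrite -{}kE => e.
    move: h; rewrite -mdeg_eq0; have := t_ge i; move: e.
    move: (t i) => ti; lia.
  rewrite /y; case: eqP => [tk|/eqP tk]; last first.
    by rewrite mul0r big1 // => m _; rewrite ffunE mcoeffZ zero ?tk ?mulr0.
  have [m0|m0] := boolP (0%MM \in msupp (x I i)).
    rewrite (bigD1_seq 0%MM) //= big1 ?addr0 ?ffunE ?mcoeffZ // => m m0'.
    by rewrite ffunE mcoeffZ zero ?m0' ?orbT ?mulr0.
  rewrite (memN_msupp_eq0 m0) mul0r big_seq big1 // => m mx.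
  rewrite ffunE mcoeffZ zero ?mulr0 //; apply/orP; right.
  by apply: contraNneq m0 => <-.
pose Sk := {J : {set 'I_n} | #|J| == k}.
have SkP (J : Sk) : #|val J| = k by case: J => J /= /eqP.
(* The [n * 'C(n, k)] families of degree [k + 1], obtained by multiplying each [y J] with each
   variable inside the free pieces. *)
pose z (j : Sk * 'I_n) (i : 'I_N) : R := y (val j.1) i *: 'X_(j.2).
have [F FP] : exists F : Sk * 'I_n -> E, forall j,
    (forall J : {set 'I_n}, #|J| != k -> F j J = 0) /\ Phi (z j) = koszul_diff
      (F j).
  apply: (fin_all_exists (P := fun j (F : E) =>
    (forall J : {set 'I_n}, #|J| != k -> F J = 0) /\ Phi (z j) = koszul_diff
      F)) => j.
  exact: inM.
pose C := [set widen_ord kn i | i in 'I_k.+1].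
have Ck : #|C| = k.+1.
  by rewrite card_imset ?card_ord // => i j /(congr1 val) /= /val_inj.
(* Linear coefficients of the [k]-forms [F j] and of one further form, the boundary of [e_C]: one
   vector more than there are coordinates. *)
pose f (a : Sk * 'I_n + unit) (b : Sk * 'I_n) : K :=
  (if a is inl j then F j (val b.1) else kgen K (mesym1 C) C (val
    b.1))@_U_(b.2).
have [|v [a va] vf] := @linear_dependence K _ _ f.
  by rewrite card_sum card_unit addn1.
pose c := v (inr tt); pose u j := v (inl j).
have {}vf (I : {set 'I_n}) q : #|I| = k ->
    \sum_j u j * (F j I)@_U_(q) + c * (kgen K (mesym1 C) C I)@_U_(q) = 0.
  move=> Ik; have Ik' : #|I| == k by apply/eqP.
  by have := vf (exist _ I Ik', q);
    rewrite big_sumType /= (big_pred1 tt) // => -[].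
(* By the choice of [v], this form has no linear coefficients. Its last term is a cycle and does not
   affect the boundary. *)
pose D : E := \sum_j u j *: F j + c *: kgen K (mesym1 C) C.
have PhiD : Phi (fun i => \sum_j u j *: z j i) = koszul_diff D.
  rewrite Phi_sum /D linearD linearZ /= koszul_diff_kgen ?mnm_supp_mesym1 //.
  rewrite scaler0 addr0 linear_sum; apply: eq_bigr => j _.
  by rewrite PhiZ linearZ /=; have [_ ->] := FP j.
(* The image under [Phi] can only live in degree [k + 1], where the boundary of [D] vanishes;
   injectivity of [Phi] then gives the claim. *)
have z0 : (fun i => \sum_j u j *: z j i) = (fun=> 0).
  apply: inj; rewrite Phi0; apply/ffunP=> L; rewrite ffunE.
  apply/mpolyP=> m; rewrite mcoeff0; apply/eqP; apply: contraT => nz.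
  suff mL : (mdeg m + #|L| = k.+1)%N.
    move: nz; rewrite PhiD koszul_diff_deg ?eqxx // => J.
      move=> Jk; rewrite /D ffunE sum_ffunE big1 ?add0r => [|j _]; last first.
        by rewrite ffunE; have [-> //] := FP j; rewrite scaler0.
      rewrite ffunE kgenE ?mnm_supp_mesym1 //.
      have [->|/kcoef_neq0[q qC JE]] := eqVneq (kcoef K C J) 0.
        by rewrite scale0r scaler0.
      by move: Jk; have := cardsD1 q C; rewrite qC -JE Ck => -[->];
        rewrite eqxx.
    move=> q Jk; rewrite /D ffunE sum_ffunE mcoeffD raddf_sum ffunE mcoeffZ /=.
    rewrite -[RHS](vf J q Jk); congr (_ + _); apply: eq_bigr => j _.
    by rewrite ffunE mcoeffZ.
  apply/eqP; apply: contraNT nz => mL.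
  rewrite PhiE sum_ffunE raddf_sum big1 //= => i _.
  have -> : \sum_j u j *: z j i = \sum_(j : Sk * 'I_n) (u j * y (val j.1) i) *:
    'X_(j.2).
    by apply: eq_bigr => j _; rewrite scalerA.
  rewrite (_ : lin_ext _ _ = \sum_(j : Sk * 'I_n)
      (u j * y (val j.1) i) *: Phi (delta i 'X_(j.2))).
    rewrite sum_ffunE raddf_sum big1 //= => j _; rewrite ffunE mcoeffZ /y.
    case: eqP => [tk|_]; last by rewrite mulr0 mul0r.
    rewrite [X in _ * X]memN_msupp_eq0 ?mulr0 //; apply: contra mL => /Phi_deg.
    by rewrite tk mdeg1; lia.
  have lsum (r : seq (Sk * 'I_n)) (cc : Sk * 'I_n -> K) T :
      lin_ext T (\sum_(j <- r) cc j *: ('X_(j.2) : R)) = \sum_(j <- r) cc j *: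
        T U_(j.2)%MM :> E.
    elim: r => [|j r IH]; first by rewrite !big_nil lin_ext0.
    by rewrite !big_cons lin_extP lin_extX IH.
  exact: lsum.
have yl l i : \sum_(J : Sk) u (J, l) * y (val J) i = 0.
  have := congr1 (fun x : 'I_N -> R => (x i)@_U_(l)) z0; rewrite mcoeff0 => h;
    rewrite -[RHS]h.
  transitivity (\sum_J \sum_q (u (J, q) *: z (J, q) i)@_U_(l)); last first.
    by rewrite raddf_sum pair_bigA /=; apply: eq_bigr => -[].
  apply: eq_bigr => J _; rewrite (bigD1 l) //= big1 ?addr0 => [|q ql].
    by rewrite !mcoeffZ mcoeffX eqxx mulr1.
  by rewrite !mcoeffZ mcoeffX eq_mnm1 (negPf ql) !mulr0.
(* For a fixed variable [l], the relation [yl] among the families [y J] is paired with the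
   coefficients of [ycoef], which single out one [J]. *)
have u0 j : u j = 0.
  case: j => J l; have [p pJ] : exists p, p \in val J.
    by apply/set0Pn; rewrite -card_gt0 SkP.
  apply: (mulIf (kcoefD1_neq0 K pJ)); rewrite mul0r.
  transitivity (\sum_(I : Sk) u (I, l) *
      \sum_i y (val I) i * (Phi (delta i 'X_[0]) (val J :\ p))@_U_(p)).
    rewrite (bigD1 J) //= ycoef ?SkP // eqxx big1 ?addr0 // => I IJ.
    by rewrite ycoef ?SkP // (inj_eq val_inj) (negPf IJ) mulr0.
  under eq_bigr => I _ do rewrite big_distrr.
  rewrite exchange_big big1 //= => i _.
  by under eq_bigr => I _ do rewrite mulrA; rewrite -big_distrl /= yl mul0r.
(* What remains is [c] times the boundary of [e_C], whose linear coefficients are not all zero. *)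
have c0 : c = 0.
  have [p pC] : exists p, p \in C by apply/set0Pn; rewrite -card_gt0 Ck.
  have Ik : #|C :\ p| = k by have := cardsD1 p C; rewrite pC Ck => -[].
  have := vf _ p Ik; rewrite big1 ?add0r => [|j _]; last by rewrite u0 mul0r.
  by rewrite kgen_top_coef // eqxx => /eqP;
    rewrite mulf_eq0 (negPf (kcoefD1_neq0 K pC)) orbF => /eqP.
by move: va; case: a => [j|[]]; rewrite -/(u _) ?u0 -?/c ?c0 eqxx.
Qed.

End UpperBound.

(** * From the multigrading to the standard grading *)

Section RowSum.
Local Open Scope ring_scope.
Variable n : nat.

Definition row_sum (M : 'rV[int]_n) : int := \sum_i M 0 i.

Lemma row_sum_is_zmod_morphism : zmod_morphism row_sum.
Proof. by move=> M N; rewrite -sumrB; apply: eq_bigr => i _; rewrite !mxE. Qed.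

HB.instance Definition _ := GRing.isZmodMorphism.Build 'rV[int]_n int row_sum
  row_sum_is_zmod_morphism.

Lemma row_sum_multi_grading i : row_sum (multi_grading i) = 1.
Proof.
rewrite /row_sum (bigD1 i) //= mxE !eqxx big1 ?addr0 // => j /negPf ji.
by rewrite mxE ji andbF.
Qed.

End RowSum.

(** A chain of primes can be shortened, so [Hdepth_ge] is downward closed in the depth; reaching
    [n - 1] but not [n] thus determines the maximum. *)
Theorem theorem3p5 (K : fieldType) (n k : nat) :
  (1 <= k)%N -> (n./2 <= k)%N -> (k < n)%N ->
  (Hdepth_ge (@std_grading n) (@syz_module K n k) (n - 1) /\
   ~ Hdepth_ge (@std_grading n) (@syz_module K n k) n) /\
  (Hdepth_ge (@multi_grading n) (@syz_module K n k) (n - 1) /\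
   ~ Hdepth_ge (@multi_grading n) (@syz_module K n k) n).
Proof.
move=> k0 nk kn; split; split; try exact: syz_Hdepth_ge.
  exact: (@syz_not_Hdepth_ge K n k int _ idfun).
exact: (syz_not_Hdepth_ge (sigma := @row_sum n) k0 kn (@row_sum_multi_grading
  n)).
Qed.
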